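(* Let $\mathcal A$ be a full-information learning algorithm with $k$ actions. If $\mathrm{SReg}_{\mathcal A}(T,\ell)\le R(T)$ for all adaptive adversaries $\ell$, then $\mathrm{SReg}_{\mathrm{MonoBandit}(\mathcal A)}(T,\ell)\le 2\sqrt{k\cdot T\cdot R(T)}$ for all adaptive adversaries $\ell$.
   Context: Online learning with $k$ actions over $T$ rounds: in each round $t$ an adaptive adversary $\ell$ picks a loss vector $\ell^t\in[0,1]^k$ as a function of the transcript of previous rounds (observed losses, selected actions, random bits used by the algorithm); the algorithm picks an action $s^t$ from its history and fresh randomness. In the bandit setting it then observes only $\ell^t[s^t]$; in the full-information setting the whole vector. Swap regret: $\mathrm{SReg}(T,\ell)=\max_{\chi:[k]\to[k]}\mathbb E[\sum_{t=1}^T(\ell^t[s^t]-\ell^t[\chi(s^t)])]$. Convention: the guarantee $R(T)$ for $\mathcal A$ is per unit of loss range, i.e. against adversaries with losses in an interval of length $c$ the regret of $\mathcal A$ is at most $c\,R(T)$. MonoBandit$(\mathcal A)$ is the following bandit algorithm with parameter $\epsilon$: in each round, with probability $1-\epsilon$ (exploit) play an action drawn from the current distribution output by $\mathcal A$ and feed $\mathcal A$ the zero vector; with probability $\epsilon/k$ for each action $j$ (explore) play $j$, observe its loss $b$, and feed $\mathcal A$ the vector with $j$-th entry $kb/\epsilon$ and all others $0$. The explore/exploit randomness is independent across rounds and of the randomness of $\mathcal A$. Here $\epsilon=\min\{1,\sqrt{kR(T)/T}\}$. *)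

(* Defs.v *)
From HB Require Import structures.
From mathcomp Require Import all_boot all_order all_algebra.
From mathcomp Require Import all_classical all_reals all_analysis.
From mathcomp Require Import measurable_realfun.

Set Implicit Arguments.
Unset Strict Implicit.
Unset Printing Implicit Defensive.

Import Order.TTheory GRing.Theory Num.Theory.

Local Open Scope classical_set_scope.
Local Open Scope ring_scope.

(* The actions are the elements of 'I_k.+1: throughout, k.+1 is the number of
   actions (measurable types must be inhabited, so zero actions is excluded).
   Actions, and the outcomes of the exploration coin, carry the discrete
   sigma-algebra. *)

HB.instance Definition _ (k : nat) := isPointed.Build 'I_k.+1 ord0.
HB.instance Definition _ (k : nat) := @isMeasurable.Build
  default_measure_display 'I_k.+1 discrete_measurable discrete_measurable0
  discrete_measurableC discrete_measurableU.

HB.instance Definition _ (k : nat) := @isMeasurable.Build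
  default_measure_display (option 'I_k.+1) discrete_measurable
  discrete_measurable0 discrete_measurableC discrete_measurableU.

Notation loss_vector R k := (k.+1.-tuple (measurableTypeR R)).

Section iid.
Context d (T : measurableType d) (R : realType) (P : probability T R).

Definition cons_tuple n (x : T * n.-tuple T) : n.+1.-tuple T :=
  [tuple of x.1 :: x.2].

Lemma measurable_cons_tuple n : measurable_fun setT (@cons_tuple n).
Proof. exact: measurable_cons. Qed.

HB.instance Definition _ n :=
  isMeasurableFun.Build _ _ _ _ (@cons_tuple n) (@measurable_cons_tuple n).

Fixpoint iid n : probability (n.-tuple T) R :=
  if n is m.+1 then distribution (P \x iid m)%E (@cons_tuple m)
  else \d_([tuple] : 0.-tuple T).
End iid.

(* A learning algorithm with k.+1 actions that observes an element of O at the
   end of each round.  In each round it draws a fresh seed from [law],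
   independently of the past, and plays [act h w], where w is the fresh seed
   and h the history: the seed, the action and the observation of each past
   round, most recent round first.  So the distribution that it outputs after
   h is the distribution of [act h] under [law]. *)
Record algorithm (R : realType) (k : nat) dO (O : measurableType dO) :=
  Algorithm {
    seed_display : measure_display;
    seed : measurableType seed_display;
    law : probability seed R;
    act : seq (seed * 'I_k.+1 * O) -> seed -> 'I_k.+1;
    measurable_act : forall t, measurable_fun setT
      (fun x : t.-tuple (seed * 'I_k.+1 * O)%type * seed => act x.1 x.2)
  }.

(* An adaptive adversary against A: the loss vector of a round is a function of
   the transcript of the past rounds, that is, of the history above. *)
Record adversary (R : realType) (k : nat) dO (O : measurableType dO)
    (A : algorithm R k O) := Adversary {
    loss_of :> seq (seed A * 'I_k.+1 * O) -> loss_vector R k;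
    measurable_loss_of : forall t, measurable_fun setT
      (fun h : t.-tuple (seed A * 'I_k.+1 * O)%type => loss_of h)
  }.

Definition losses_in (R : realType) (k : nat) dO (O : measurableType dO)
    (A : algorithm R k O) (ell : adversary A) (a b : R) : Prop :=
  forall h i, a <= tnth (ell h) i <= b.

Section regret.
Context (R : realType) (k : nat) dO (O : measurableType dO).
Variable feedback : loss_vector R k -> 'I_k.+1 -> O.
Variables (A : algorithm R k O) (ell : adversary A).

Definition observed (r : seed A * 'I_k.+1 * loss_vector R k) :
    seed A * 'I_k.+1 * O :=
  (r.1, feedback r.2 r.1.2).

(* The seed, action and full loss vector of every round of a run in which the
   successive seeds are given by ws, most recent round first. *)
Fixpoint run (ws : seq (seed A)) : seq (seed A * 'I_k.+1 * loss_vector R k) :=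
  if ws is w :: ws' then
    let past := run ws' in
    let h := map observed past in
    (w, act h w, ell h) :: past
  else [::].

Definition swap_gain (chi : 'I_k.+1 -> 'I_k.+1) (ws : seq (seed A)) : R :=
  \sum_(r <- run ws) (tnth r.2 r.1.2 - tnth r.2 (chi r.1.2)).

Definition SReg (T : nat) : \bar R :=
  (\big[maxe/-oo]_(chi : {ffun 'I_k.+1 -> 'I_k.+1})
     'E_(iid (law A) T)[fun ws => swap_gain chi ws])%E.

End regret.

Definition full_information (R : realType) (k : nat)
    (l : loss_vector R k) (_ : 'I_k.+1) : loss_vector R k := l.

Definition bandit (R : realType) (k : nat)
    (l : loss_vector R k) (s : 'I_k.+1) : measurableTypeR R := tnth l s.

Section exploration.
Context (R : realType) (k : nat) (eps : {i01 R}).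

(* None stands for exploiting and Some j for exploring action j. *)
Definition exploration_law : set (option 'I_k.+1) -> \bar R :=
  measure_add
    (mscale (1 - eps%:num)%:nng \d_None)
    (mscale (eps%:num / k.+1%:R)%:nng
      (msum (fun j => \d_(Some (inord j))) k.+1)).

HB.instance Definition _ := Measure.on exploration_law.

Let exploration_law_setT : exploration_law [set: _] = 1%E.
Proof.
have dT (z : option 'I_k.+1) : (\d_z [set: option 'I_k.+1] = 1 :> \bar R)%E.
  by rewrite diracE in_setT.
transitivity ((1 - eps%:num)%:E * \d_None [set: option 'I_k.+1] +
    (eps%:num / k.+1%:R)%:E *
      \sum_(j < k.+1) \d_(Some (inord j)) [set: option 'I_k.+1])%E.
  by rewrite /exploration_law measure_addE.
rewrite dT (eq_bigr (fun=> 1%E)) => [|j _]; last by rewrite dT.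
rewrite sumEFin sumr_const card_ord -!EFinM -EFinD mulr1 -mulrA mulVf ?mulr1.
  by rewrite subrK.
by rewrite pnatr_eq0.
Qed.

HB.instance Definition _ := @Measure_isProbability.Build _ _ R
  exploration_law exploration_law_setT.

End exploration.
Arguments exploration_law {R} k eps.

Section mono_bandit.
Context (R : realType) (k : nat).
Variables (eps : {i01 R}) (A : algorithm R k (loss_vector R k)).

(* This is the zero vector when z is None.  If eps is 0 the division yields 0,
   but then exploration has probability 0. *)
Definition estimate (z : option 'I_k.+1) (b : R) : loss_vector R k :=
  [tuple if z == Some i then k.+1%:R * b / eps%:num else 0 | i < k.+1].

(* The history of the copy of A that MonoBandit runs.  In every round this copy
   draws its seed and its own action, also in the rounds in which an
   exploration replaces that action by another one. *)
Fixpoint simulated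
    (h : seq (seed A * option 'I_k.+1 * 'I_k.+1 * measurableTypeR R)) :
    seq (seed A * 'I_k.+1 * loss_vector R k) :=
  if h is (w, z, _, b) :: h' then
    let g := simulated h' in (w, act g w, estimate z b) :: g
  else [::].

Definition mono_act
    (h : seq (seed A * option 'I_k.+1 * 'I_k.+1 * measurableTypeR R))
    (wz : seed A * option 'I_k.+1) : 'I_k.+1 :=
  if wz.2 is Some j then j else act (simulated h) wz.1.

Lemma measurable_mono_act t : measurable_fun setT
  (fun x : t.-tuple (seed A * option 'I_k.+1 * 'I_k.+1 *
                     measurableTypeR R)%type * (seed A * option 'I_k.+1) =>
   mono_act x.1 x.2).
Proof.
have discr d2 (T2 : measurableType d2) (f : option 'I_k.+1 -> T2) : measurable_fun setT f.
  by move=> _ Y _; exact: I.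
have size_sim h : size (simulated h) = size h.
  by elim: h => [//|[[[w z] s] b] h /= ->].
pose H := (seed A * option 'I_k.+1 * 'I_k.+1 * measurableTypeR R)%type.
have sizeP n (h : n.-tuple H) : size (simulated h) == n.
  by rewrite size_sim size_tuple.
pose sim n h : n.-tuple (seed A * 'I_k.+1 * loss_vector R k)%type :=
  Tuple (sizeP n h).
have mest : measurable_fun setT
    (fun x : option 'I_k.+1 * measurableTypeR R => estimate x.1 x.2).
  apply/measurable_fun_tnthP => i.
  rewrite (_ : _ \o _ = fun x : option 'I_k.+1 * measurableTypeR R =>
    if x.1 == Some i then k.+1%:R * x.2 / eps%:num else 0); last first.
    by apply/funext => x /=; rewrite tnth_mktuple.
  apply: measurable_fun_ifT => //.
    by apply: (measurableT_comp (f := fun z => z == Some i)).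
  apply: measurable_funM => //.
  exact: measurable_funM.
have msim n : measurable_fun setT (sim n).
  elim: n => [|n IH].
    rewrite (_ : sim 0 = cst [tuple]) //.
    by apply/funext => h; rewrite (tuple0 (sim 0 h)).
  pose h0 (h : n.+1.-tuple H) : H := tnth h ord0.
  pose h' (h : n.+1.-tuple H) : n.-tuple H := [tuple of behead h].
  have mh0 : measurable_fun setT h0 by exact: measurable_tnth.
  have mh' : measurable_fun setT h' by exact: measurable_behead.
  have mg : measurable_fun setT (sim n \o h') by exact: measurableT_comp.
  have mw : measurable_fun setT (fun h => (h0 h).1.1.1).
    by do 3 apply: measurableT_comp => //.
  have mz : measurable_fun setT (fun h => (h0 h).1.1.2).
    by do 3 apply: measurableT_comp => //.
  have mb : measurable_fun setT (fun h => (h0 h).2).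
    by apply: measurableT_comp.
  rewrite (_ : sim n.+1 = fun h => [tuple of
    ((h0 h).1.1.1, act (sim n (h' h)) (h0 h).1.1.1,
      estimate (h0 h).1.1.2 (h0 h).2) :: sim n (h' h)]); last first.
    apply/funext => h; apply/val_inj => /=.
    by case/tupleP: h => [[[[w z] s] b] h].
  apply: measurable_cons => //.
  apply/measurable_fun_pairP; split => /=.
    apply/measurable_fun_pairP; split => //=.
    exact: (measurableT_comp (@measurable_act _ _ _ _ A n)
      (measurable_fun_pair mg mw)).
  exact: (measurableT_comp mest (measurable_fun_pair mz mb)).
rewrite (_ : (fun _ => _) = fun x : t.-tuple H * (seed A * option 'I_k.+1) =>
  if x.2.2 == None then act (sim t x.1) x.2.1 else odflt ord0 x.2.2); last first.
  by apply/funext => -[h [w [j|]]].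
have m1 : measurable_fun setT
    (fun x : t.-tuple H * (seed A * option 'I_k.+1) => sim t x.1).
  exact: (measurableT_comp (msim t) measurable_fst).
have m2 : measurable_fun setT
    (fun x : t.-tuple H * (seed A * option 'I_k.+1) => x.2.1).
  exact: (measurableT_comp measurable_fst measurable_snd).
have m3 : measurable_fun setT
    (fun x : t.-tuple H * (seed A * option 'I_k.+1) => x.2.2).
  exact: (measurableT_comp measurable_snd measurable_snd).
apply: measurable_fun_ifT.
- exact: (measurableT_comp (discr _ _ (fun z => z == None)) m3).
- exact: (measurableT_comp (@measurable_act _ _ _ _ A t)
    (measurable_fun_pair m1 m2)).
- exact: (measurableT_comp (discr _ _ (odflt ord0)) m3).
Qed.

Definition MonoBandit : algorithm R k (measurableTypeR R) :=
  Algorithm (law A \x exploration_law k eps)%E measurable_mono_act.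

End mono_bandit.

Definition mono_eps (R : realType) (k T : nat) (r : R) : {i01 R} :=
  (Num.min 1 (Num.sqrt (k.+1%:R * r / T%:R)))%:i01.

(* Main.v *)
(* Run A against the estimates that MonoBandit feeds to it.  For each fixed
   sequence of exploration coins these estimates form a deterministic adaptive
   adversary against A with losses in [0, K / eps], K the number of actions, so
   by Fubini the expected regret of A on the estimates is at most K / eps * R.
   The estimates being unbiased, in each round the expected regret of MonoBandit
   is 1 - eps times that of A on the estimates plus at most eps for exploring,
   whence the bound (1 - eps) * K / eps * R + eps * T.  If eps = 0 then R <= 0, which
   forces T = 0 or K = 1: with K > 1, a unit loss on a single action in the last
   round gives R >= P(that action is played), and these sum to 1. *)
Require Import Defs.
From mathcomp Require Import all_boot all_order all_algebra.
From mathcomp Require Import all_classical all_reals all_analysis.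
From mathcomp Require Import measurable_realfun ring lra.

Set Implicit Arguments.
Unset Strict Implicit.
Unset Printing Implicit Defensive.

Import Order.TTheory GRing.Theory Num.Theory.

Local Open Scope ring_scope.

(** * Expectations of bounded functions *)

Section bounded_expectation.
Context d (T : measurableType d) (R : realType) (P : probability T R).

Lemma bounded_Lfun1 (f : T -> R) (c : R) : measurable_fun setT f ->
  (forall x, `|f x| <= c) -> f \in Lfun P 1.
Proof.
move=> mf fc; apply/Lfun1_integrable.
apply: measurable_bounded_integrable => //.
by rewrite [X in (X < _)%E](probability_setT P) ltry.
by exists c; split=> [|M cM x _]; [exact: num_real|exact: le_trans (fc x) (ltW cM)].
Qed.

Lemma expectationD_cst (f : T -> R) (c r : R) : measurable_fun setT f ->
  (forall x, `|f x| <= c) -> 'E_P[fun x => (f x + r)%R]%E = ('E_P[f] + r%:E)%E.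
Proof.
move=> mf fc; rewrite -[in RHS](expectation_cst P).
rewrite -expectationD //; first exact: (bounded_Lfun1 mf fc).
by apply: (@bounded_Lfun1 _ `|r|) => // x.
Qed.

End bounded_expectation.

(** Tonelli for the nonnegative function [f + c]; the finite shift is cancelled afterwards. *)
Lemma expectation_prod_le d1 (T1 : measurableType d1) d2
    (T2 : measurableType d2) (R : realType) (P : probability T1 R)
    (Q : probability T2 R) (f : T1 * T2 -> R) (c e : R) :
  measurable_fun setT f -> (forall x, `|f x| <= c) ->
  (forall x, 'E_Q[fun y => f (x, y)] <= e%:E)%E ->
  ('E_(P \x Q)%E[f] <= e%:E)%E.
Proof.
move=> mf fc fe; rewrite -(@leeD2rE _ c%:E) //.
rewrite -(expectationD_cst _ _ mf fc) unlock fubini_tonelli1; last 2 first.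
- by apply/measurable_EFinP; exact: measurable_funD.
- by move=> x /=; rewrite lee_fin; have := fc x; rewrite ler_norml; lra.
have mfx x : measurable_fun setT (fun y => f (x, y)).
  exact: (measurableT_comp mf (measurable_pair1 x)).
have ge0 x y : (0 <= (f (x, y) + c)%:E)%E.
  by rewrite lee_fin; have := fc (x, y); rewrite ler_norml; lra.
have fx x : (fubini_F Q (fun z => (f z + c)%:E) x <= (e + c)%:E)%E.
  have := expectationD_cst Q c (mfx x) (fun y => fc (x, y)).
  by have := fe x; rewrite /fubini_F unlock EFinD => ? ->; rewrite leeD2r.
apply: (@le_trans _ _ (\int[P]_x (e + c)%:E)%E); last first.
  by rewrite integral_cst //= probability_setT mule1.
apply: ge0_le_integral => //.
- by move=> x _; apply: integral_ge0.
- apply: measurable_fun_fubini_tonelli_F => [|[x y]//].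
  by apply/measurable_EFinP; exact: measurable_funD.
Qed.

Lemma norm_le_size (T : Type) (R : realType) (F : seq T -> R) (c : R) x :
  F [::] = 0 -> (forall w x, `|F (w :: x) - F x| <= c) ->
  `|F x| <= (size x)%:R * c.
Proof.
move=> F0 Fc; elim: x => [|w x IH]; first by rewrite F0 normr0 mul0r.
by have := Fc w x; move: IH; rewrite -natr1 !ler_norml /=; lra.
Qed.

(** * Conditioning on the past in i.i.d. runs *)

Section iid_integral.
Context d (T : measurableType d) (R : realType) (P : probability T R).

(** The head of the tuple is the newest seed, so the inner integral conditions on the past [x]. *)
Lemma ge0_integral_iidS n (f : n.+1.-tuple T -> \bar R) :
  measurable_fun setT f -> (forall x, 0 <= f x)%E ->
  (\int[iid P n.+1]_x f x =
   \int[iid P n]_x \int[P]_w f (Defs.cons_tuple (w, x)))%E.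
Proof.
move=> mf f0 /=; rewrite ge0_integral_distribution //.
rewrite fubini_tonelli2 => [//||x]; last exact: f0.
exact: (measurableT_comp mf (@measurable_cons_tuple _ _ _)).
Qed.

(** A supermartingale argument: [F] minus [e] per round does not increase in conditional
    expectation. The bound [c] on the increments makes [F] bounded on tuples, hence integrable. *)
Lemma expectation_iid_drift (F : seq T -> R) (c e : R) (n : nat) :
  (forall m, measurable_fun setT (fun x : m.-tuple T => F x)) ->
  F [::] = 0 ->
  (forall w x, `|F (w :: x) - F x| <= c) ->
  (forall x, 'E_P[fun w => (F (w :: x) - F x)%R] <= e%:E)%E ->
  ('E_(iid P n)[fun x => F x] <= (n%:R * e)%:E)%E.
Proof.
move=> mF F0 Fc Fe.
have Fb m (x : m.-tuple T) : `|F x| <= m%:R * c.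
  by have := norm_le_size x F0 Fc; rewrite size_tuple.
elim: n => [|n IH].
  rewrite (_ : (fun=> _) = cst 0) ?expectation_cst ?mul0r //.
  by apply/funext => x; rewrite tuple0.
(* Adding the bound makes the integrands nonnegative, as Tonelli requires. *)
rewrite -(@leeD2rE _ (n.+1%:R * c)%:E) //.
rewrite -(expectationD_cst _ _ (mF _) (@Fb _)) unlock ge0_integral_iidS; last 2 first.
- by apply/measurable_EFinP; apply: measurable_funD => //; exact: mF.
- by move=> x; rewrite lee_fin; have := Fb _ x; rewrite ler_norml; lra.
(* Integrating out the newest seed leaves at most [F x + e]; [r] is [e] plus the shift. *)
set r := n.+1%:R * c + e.
have mFc x : measurable_fun setT (fun w => F (Defs.cons_tuple (w, x : n.-tuple T))).
  apply: (measurableT_comp (mF n.+1)).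
  exact: (measurableT_comp (@measurable_cons_tuple _ _ _) (measurable_pair2 x)).
have mFD x : measurable_fun setT (fun w => F (w :: (x : n.-tuple T)) - F x).
  by apply: measurable_funB => //; exact: (mFc x).
have inner x : (\int[P]_w (F (Defs.cons_tuple (w, x : n.-tuple T)) + n.+1%:R * c)%:E
    <= (F x + r)%:E)%E.
  (* For fixed [x] the value [F x] is a constant; added back to the increment it recovers [F] of the
     longer tuple. *)
  have := expectationD_cst P (F x + n.+1%:R * c) (mFD x) (fun w => Fc w x).
  have := Fe x; rewrite unlock => Fex.
  under eq_integral do rewrite addrA subrK.
  move=> ->; apply: (le_trans (leeD2r _ Fex)).
  by rewrite -EFinD lee_fin /r; lra.
apply: (@le_trans _ _ (\int[iid P n]_x (F x + r)%:E)%E).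
  apply: ge0_le_integral => //.
  - move=> x _; apply: integral_ge0 => w _; rewrite lee_fin.
    by have := Fb _ (Defs.cons_tuple (w, x)); rewrite ler_norml; lra.
  - apply: (@measurable_fun_fubini_tonelli_G _ _ _ _ _ _ (fun z => (F (Defs.cons_tuple z)
      + n.+1%:R * c)%:E)) => [|z]; last first.
      by have := Fb _ (Defs.cons_tuple z); rewrite lee_fin ler_norml; lra.
    apply/measurable_EFinP; apply: measurable_funD => //.
    exact: (measurableT_comp (mF n.+1) (@measurable_cons_tuple _ _ _)).
  - by apply/measurable_EFinP; apply: measurable_funD => //; exact: mF.
have := expectationD_cst (iid P n) r (mF n) (@Fb n); rewrite unlock => ->.
move: IH; rewrite unlock => IH.
apply: (le_trans (leeD2r _ IH)); rewrite -!EFinD lee_fin /r -natr1; lra.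
Qed.

End iid_integral.

(** * Fixing the exploration coins *)

(* [zeta i] is the coin of round i, the oldest round being round 0 and the last
   one of the list. *)
Fixpoint with_coins S Z (zeta : nat -> Z) (ws : seq S) : seq (S * Z) :=
  if ws is w :: ws' then (w, zeta (size ws')) :: with_coins zeta ws' else [::].

Lemma size_with_coins S Z (zeta : nat -> Z) (ws : seq S) :
  size (with_coins zeta ws) = size ws.
Proof. by elim: ws => //= w ws ->. Qed.

Canonical with_coins_tuple S Z (zeta : nat -> Z) n (ws : n.-tuple S) :
    n.-tuple (S * Z) :=
  @Tuple n _ (with_coins zeta ws)
    (introT eqP (etrans (size_with_coins zeta ws) (size_tuple ws))).

Lemma eq_with_coins S Z (zeta zeta' : nat -> Z) (ws : seq S) :
  (forall i, (i < size ws)%N -> zeta i = zeta' i) ->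
  with_coins zeta ws = with_coins zeta' ws.
Proof.
elim: ws => //= w ws IH eqz; rewrite eqz // IH // => i ltiw.
by apply: eqz; apply: ltnW.
Qed.

Lemma measurable_with_coins d (S : measurableType d) d' (Z : measurableType d')
    (zeta : nat -> Z) n :
  measurable_fun setT (fun ws : n.-tuple S => [tuple of with_coins zeta ws]).
Proof.
elim: n => [|n IH].
  rewrite (_ : (fun=> _) = cst [tuple]) //.
  by apply/funext => ws; rewrite [RHS]tuple0; exact: tuple0.
rewrite (_ : (fun=> _) = fun ws => [the n.+1.-tuple (S * Z)%type of
  (thead ws, zeta n) :: [tuple of with_coins zeta [tuple of behead ws]]]).
  apply: measurable_cons.
    apply: measurable_fun_pair => //; exact: measurable_tnth.
  exact: (measurableT_comp IH (@measurable_behead _ _ n)).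
apply/funext => ws; apply: val_inj; case/tupleP: ws => w ws /=.
by rewrite theadE size_tuple.
Qed.

(** Tonelli with the coins outermost. The induction peels off the newest round and is applied to [F]
    with the newest seed integrated out and the newest coin fixed, hence the generality in [F]. *)
Lemma ge0_integral_iid_prod_le d (S : measurableType d) d'
    (Z : measurableType d') (R : realType) (P : probability S R)
    (Q : probability Z R) n (F : n.-tuple (S * Z) -> \bar R) (B : \bar R) :
  measurable_fun setT F -> (forall x, 0 <= F x)%E ->
  (forall zeta, \int[iid P n]_ws F [tuple of with_coins zeta ws] <= B)%E ->
  (\int[iid (P \x Q)%E n]_x F x <= B)%E.
Proof.
elim: n F => [|n IH] F mF F0 FB.
  have := FB (fun=> point); rewrite /= !integral_dirac //; last first.
    by apply: measurableT_comp => //; exact: measurable_with_coins.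
  by rewrite !diracE !in_setT; congr (_ * F _ <= _)%E; rewrite [LHS]tuple0.
have mFc : measurable_fun setT (fun y : (S * Z) * n.-tuple (S * Z) =>
    F (Defs.cons_tuple y)).
  exact: (measurableT_comp mF (@measurable_cons_tuple _ _ _)).
(* The variables are regrouped as past, newest coin, newest seed, so that the seed can be integrated
   out first. *)
pose H (y : (n.-tuple (S * Z) * Z) * S) := F (Defs.cons_tuple ((y.2, y.1.2), y.1.1)).
have mH : measurable_fun setT H.
  apply: (measurableT_comp mF).
  apply: (measurableT_comp (@measurable_cons_tuple _ _ _)).
  apply: measurable_fun_pair => /=.
    apply: measurable_fun_pair => //.
    exact: (measurableT_comp measurable_snd measurable_fst).
  exact: (measurableT_comp measurable_fst measurable_fst).
pose G xz := (\int[P]_w H (xz, w))%E.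
have mG : measurable_fun setT G by apply: (measurable_fun_fubini_tonelli_F H mH) => y; rewrite /H.
have G0 xz : (0 <= G xz)%E by apply: integral_ge0 => w _; rewrite /H.
have mGz z : measurable_fun setT (fun x => G (x, z)).
  exact: (measurableT_comp mG (measurable_pair2 z)).
rewrite ge0_integral_iidS //.
rewrite (eq_integral (fun x => \int[Q]_z G (x, z))%E) => [|x _]; last first.
  rewrite fubini_tonelli2 //.
  exact: (measurableT_comp mFc (measurable_pair2 x)).
(* The swap makes the newest coin [z] the outer variable; it then suffices to bound the integral
   over the past for each [z]. *)
rewrite fubini_tonelli //.
apply: (@le_trans _ _ (\int[Q]_z B)%E); last first.
  by rewrite integral_cst //= probability_setT mule1.
apply: ge0_le_integral => //.
- by move=> z _; apply: integral_ge0.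
- exact: measurable_fun_fubini_tonelli_G.
move=> z _; apply: IH => // zeta.
(* Rounds count from 0, so the newest of [n.+1] coins has index [n]; [zeta] supplies the older
   ones. *)
have := FB (fun i => if i == n then z else zeta i).
rewrite ge0_integral_iidS //.
  apply: le_trans; rewrite le_eqVlt; apply/orP; left; apply/eqP.
  apply: eq_integral => ws _; apply: eq_integral => w _.
  rewrite /H; congr (F _); apply: val_inj => /=.
  rewrite size_tuple eqxx; congr (_ :: _); apply: eq_with_coins => i.
  by rewrite size_tuple; case: eqP => // ->; rewrite ltnn.
apply: (measurableT_comp mF); exact: measurable_with_coins.
Qed.

Lemma expectation_exploration (R : realType) (k : nat) (eps : {i01 R})
    (f : option 'I_k.+1 -> R) :
  'E_(exploration_law k eps)[f]%E = ((1 - eps%:num) * f None +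
     eps%:num / k.+1%:R * \sum_(j < k.+1) f (Some j))%:E.
Proof.
have mf (g : option 'I_k.+1 -> R) : measurable_fun setT g by move=> _ Y _; exact: I.
(* Replacing [f] by [f + c] raises both sides by exactly [c], as the weights sum to 1. *)
wlog f0 : f / forall z, 0 <= f z => [hw|].
  pose c := \sum_z `|f z|.
  have fc z : `|f z| <= c.
    by rewrite /c (bigD1 z) //= lerDl sumr_ge0.
  have fc0 z : 0 <= f z + c by have := fc z; rewrite ler_norml; lra.
  have := hw _ fc0; rewrite (expectationD_cst _ _ (mf f) fc).
  have k0 : k.+1%:R != 0 :> R by rewrite pnatr_eq0.
  rewrite big_split sumr_const card_ord /= -mulr_natl.
  move/(congr1 (fun x => x - c%:E)%E); rewrite addeK // => ->.
  by rewrite -EFinB; congr _%:E; field; rewrite ?k0 //.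
have fE0 z : [set: option 'I_k.+1]%classic z -> (0 <= (f z)%:E)%E by rewrite lee_fin.
have mE (g : option 'I_k.+1 -> \bar R) : measurable_fun setT g by move=> _ Y _; exact: I.
have intd z : (\int[\d_z]_x (f x)%:E = (f z)%:E)%E.
  by rewrite integral_dirac // diracE in_setT mul1e.
rewrite unlock ge0_integral_measure_add // !ge0_integral_mscale //.
rewrite ge0_integral_measure_sum // intd.
under eq_bigr do rewrite intd.
rewrite sumEFin -!EFinM -EFinD; congr (_ + _ * _)%:E.
by apply: eq_bigr => j _; rewrite inord_val.
Qed.

(** * Measurability of histories and swap gains *)

Lemma measurable_fun_fin_case d (T : measurableType d) (R : realType)
    (I : finType) (a : T -> I) (g : I -> T -> R) :
  (forall j, measurable_fun setT (fun x => a x == j)) ->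
  (forall j, measurable_fun setT (g j)) ->
  measurable_fun setT (fun x => g (a x) x).
Proof.
(* A finite sum of cut-off functions, in which only the term [j = a x] survives. *)
move=> ma mg; rewrite (_ : (fun=> _) =
    fun x => \sum_(j : I) if a x == j then g j x else 0); last first.
  apply/funext => x; rewrite (bigD1 (a x)) //= eqxx big1 ?addr0 // => j.
  by rewrite eq_sym => /negPf ->.
by apply: measurable_sum => j; apply: measurable_fun_ifT.
Qed.

Lemma measurable_fun_action_case d (T : measurableType d) (R : realType) k
    (a : T -> 'I_k.+1) (g : 'I_k.+1 -> T -> R) :
  measurable_fun setT a -> (forall j, measurable_fun setT (g j)) ->
  measurable_fun setT (fun x => g (a x) x).
Proof.
move=> ma; apply: measurable_fun_fin_case => j.
exact: (measurableT_comp (f := fun i : 'I_k.+1 => i == j)).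
Qed.

Section history.
Context (R : realType) (k : nat) dO (O : measurableType dO).
Variable feedback : loss_vector R k -> 'I_k.+1 -> O.
Variables (A : algorithm R k O) (ell : adversary A).
Hypothesis measurable_feedback : measurable_fun setT
  (fun x : loss_vector R k * 'I_k.+1 => feedback x.1 x.2).

Definition history (ws : seq (seed A)) : seq (seed A * 'I_k.+1 * O) :=
  map (@observed R k dO O feedback A) (run feedback ell ws).

Lemma size_history ws : size (history ws) = size ws.
Proof. by elim: ws => //= w ws; rewrite /history /= => ->. Qed.

Definition history_tuple n (ws : n.-tuple (seed A)) :
    n.-tuple (seed A * 'I_k.+1 * O)%type :=
  @Tuple n _ (history ws)
    (introT eqP (etrans (size_history ws) (size_tuple ws))).

Lemma measurable_next_loss n : measurable_fun setT (@history_tuple n) ->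
  measurable_fun setT (fun ws : n.-tuple (seed A) => ell (history ws)).
Proof. by move=> mh; exact: (measurableT_comp (@measurable_loss_of _ _ _ _ _ ell n) mh). Qed.

Lemma measurable_next_act n d (X : measurableType d)
    (ws : X -> n.-tuple (seed A)) (w : X -> seed A) :
  measurable_fun setT (@history_tuple n) ->
  measurable_fun setT ws -> measurable_fun setT w ->
  measurable_fun setT (fun x => act (history (ws x)) (w x)).
Proof.
move=> mh mws mw; apply: (measurableT_comp (@measurable_act _ _ _ _ A n)
  (measurable_fun_pair (measurableT_comp mh mws) mw)).
Qed.

Lemma measurable_history n : measurable_fun setT (@history_tuple n).
Proof.
elim: n => [|n IH].
  rewrite (_ : @history_tuple 0 = cst [tuple]) //.
  by apply/funext => ws; rewrite [RHS]tuple0; exact: tuple0.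
pose t (ws : n.+1.-tuple (seed A)) : n.-tuple (seed A) := [tuple of behead ws].
have mt : measurable_fun setT t by exact: measurable_behead.
have mth : measurable_fun setT (@thead n (seed A)) by exact: measurable_tnth.
rewrite (_ : @history_tuple n.+1 = fun ws => [the n.+1.-tuple _ of
  (thead ws, act (history (t ws)) (thead ws),
    feedback (ell (history (t ws))) (act (history (t ws)) (thead ws)))
     :: history_tuple (t ws)]); last first.
  by apply/funext => ws; apply: val_inj; case/tupleP: ws => w ws /=.
have mact := measurable_next_act IH mt mth.
apply: measurable_cons; last exact: (measurableT_comp IH mt).
apply: measurable_fun_pair.
  exact: measurable_fun_pair.
exact: (measurableT_comp measurable_feedback (measurable_fun_pair
  (measurableT_comp (measurable_next_loss IH) mt) mact)).
Qed.

Lemma swap_gain_cons chi w ws : swap_gain feedback ell chi (w :: ws) =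
  (tnth (ell (history ws)) (act (history ws) w) -
   tnth (ell (history ws)) (chi (act (history ws) w))) +
  swap_gain feedback ell chi ws.
Proof. by rewrite /swap_gain /= big_cons. Qed.

Lemma measurable_swap_gain chi n : measurable_fun setT
  (fun ws : n.-tuple (seed A) => swap_gain feedback ell chi ws).
Proof.
elim: n => [|n IH].
  rewrite (_ : (fun=> _) = cst 0) //; apply/funext => ws.
  by rewrite tuple0 /swap_gain big_nil.
pose t (ws : n.+1.-tuple (seed A)) : n.-tuple (seed A) := [tuple of behead ws].
have mt : measurable_fun setT t by exact: measurable_behead.
have mth : measurable_fun setT (@thead n (seed A)) by exact: measurable_tnth.
have mact := measurable_next_act (@measurable_history n) mt mth.
pose l ws := ell (history (t ws)).
have ml : measurable_fun setT l.
  exact: (measurableT_comp (measurable_next_loss (@measurable_history n)) mt).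
rewrite (_ : (fun=> _) = fun ws =>
  (tnth (l ws) (act (history (t ws)) (thead ws)) -
   tnth (l ws) (chi (act (history (t ws)) (thead ws)))) +
  swap_gain feedback ell chi (t ws)); last first.
  by apply/funext => ws; case/tupleP: ws => w ws; rewrite swap_gain_cons.
apply: measurable_funD; last exact: (measurableT_comp IH mt).
apply: (measurable_fun_action_case (g := fun a ws => tnth (l ws) a - tnth (l ws) (chi a)) mact) => j.
apply: measurable_funB; exact: (measurableT_comp (measurable_tnth _) ml).
Qed.

End history.

(** * The importance-weighted loss estimates *)

Lemma tnth_estimate (R : realType) k (eps : {i01 R}) (z : option 'I_k.+1) b i :
  tnth (estimate eps z b) i = if z == Some i then k.+1%:R * b / eps%:num else 0.
Proof. by rewrite tnth_mktuple. Qed.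

(** Only the exploration of [i] touches entry [i]. For nonzero [eps], multiplying by the probability
    [eps / k.+1] of each exploration gives back [tnth l i]: the estimate is unbiased. *)
Lemma sum_estimate (R : realType) k (eps : {i01 R}) (l : loss_vector R k) i :
  \sum_(j < k.+1) tnth (estimate eps (Some j) (tnth l j)) i =
  k.+1%:R / eps%:num * tnth l i.
Proof.
rewrite (bigD1 i) //= big1 => [|j ji]; last first.
  by rewrite tnth_estimate; case: eqP => // -[ij]; rewrite ij eqxx in ji.
by rewrite tnth_estimate eqxx addr0 mulrAC.
Qed.

Lemma estimate_bounds (R : realType) k (eps : {i01 R}) (z : option 'I_k.+1) b i :
  0 <= b <= 1 -> 0 <= tnth (estimate eps z b) i <= k.+1%:R / eps%:num.
Proof.
move=> /andP[b0 b1]; have e0 : 0 <= eps%:num :> R by [].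
rewrite tnth_estimate; case: ifP => _; last by rewrite lexx divr_ge0.
rewrite divr_ge0 ?mulr_ge0 //= ler_wpM2r ?invr_ge0 //.
by rewrite ler_piMr.
Qed.

Lemma measurable_estimate (R : realType) k (eps : {i01 R}) (z : option 'I_k.+1) :
  measurable_fun setT (estimate eps z : measurableTypeR R -> loss_vector R k).
Proof.
apply/measurable_fun_tnthP => i; rewrite (_ : _ \o _ = fun b =>
    if z == Some i then k.+1%:R * b / eps%:num else 0); last first.
  by apply/funext => b; rewrite /= tnth_estimate.
case: (z == Some i) => //.
by apply: measurable_funM => //; exact: measurable_funM.
Qed.

Lemma measurable_full_information (R : realType) k : measurable_fun setT
  (fun x : loss_vector R k * 'I_k.+1 => full_information x.1 x.2).
Proof. exact: measurable_fst. Qed.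

Lemma measurable_bandit (R : realType) k : measurable_fun setT
  (fun x : loss_vector R k * 'I_k.+1 => bandit x.1 x.2).
Proof.
apply: (measurable_fun_action_case (a := snd)
  (g := fun j (x : loss_vector R k * 'I_k.+1) => tnth x.1 j)) => // j.
exact: (measurableT_comp (measurable_tnth _) measurable_fst).
Qed.

Lemma norm_gain (R : realType) k (l : loss_vector R k) (a b : 'I_k.+1) (c : R) :
  (forall i, 0 <= tnth l i <= c) -> `|tnth l a - tnth l b| <= c.
Proof. by move=> lc; move: (lc a) (lc b); rewrite ler_norml; lra. Qed.

(** * MonoBandit compared with its simulated copy of [A] *)

Section reduction.
Context (R : realType) (k : nat) (eps : {i01 R}).
Context (A : algorithm R k (loss_vector R k)).
Variable ell : adversary (MonoBandit eps A).
Hypothesis ell01 : losses_in ell 0 1.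

Let hist : seq (seed A * option 'I_k.+1) -> _ := history (@bandit R k) ell.

(** A function of the seeds of MonoBandit, hence comparable with MonoBandit's own gain run by
    run. *)
Definition simulated_gain (chi : 'I_k.+1 -> 'I_k.+1) x : R :=
  \sum_(r <- simulated eps (hist x)) (tnth r.2 r.1.2 - tnth r.2 (chi r.1.2)).

Let est x (wz : seed A * option 'I_k.+1) : loss_vector R k :=
  estimate eps wz.2 (tnth (ell (hist x)) (mono_act eps (hist x) wz)).

(** The copy's own action is the one that MonoBandit would play on the same seed with the coin
    [None]. *)
Lemma simulated_gain_cons chi wz x : simulated_gain chi (wz :: x) =
  (tnth (est x wz) (mono_act eps (hist x) (wz.1, None)) -
   tnth (est x wz) (chi (mono_act eps (hist x) (wz.1, None)))) +
  simulated_gain chi x.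
Proof. by case: wz => w z; rewrite /simulated_gain /= big_cons. Qed.

(** The estimate depends on the coin but not on the seed: exploring [j] forces action [j], and
    exploiting gives the zero vector whatever loss is put in. *)
Let estE x wz : est x wz = estimate eps wz.2 (tnth (ell (hist x)) (odflt ord0 wz.2)).
Proof.
by rewrite /est; case: wz => w [j|].
Qed.

Let est_bounds x wz i : 0 <= tnth (est x wz) i <= k.+1%:R / eps%:num.
Proof. by apply: estimate_bounds; exact: ell01. Qed.

Lemma measurable_simulated_gain chi n : measurable_fun setT
  (fun x : n.-tuple (seed A * option 'I_k.+1) => simulated_gain chi x).
Proof.
elim: n => [|n IH].
  rewrite (_ : (fun=> _) = cst 0) //; apply/funext => x.
  by rewrite tuple0 /simulated_gain big_nil.
pose S := (seed A * option 'I_k.+1)%type.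
pose t (x : n.+1.-tuple S) : n.-tuple S := [tuple of behead x].
have mt : measurable_fun setT t by exact: measurable_behead.
have mth : measurable_fun setT (@thead n S) by exact: measurable_tnth.
have mh := @measurable_history _ _ _ _ _ _ ell (@measurable_bandit R k) n.
pose a x := mono_act eps (hist (t x)) ((thead x).1, None).
have ma : measurable_fun setT a.
  have mw : measurable_fun setT
      (fun x : n.+1.-tuple S => ((thead x).1, None) : seed (MonoBandit eps A)).
    apply: measurable_fun_pair => //.
    exact: (measurableT_comp measurable_fst mth).
  exact: (measurable_next_act mh mt mw).
have ml : measurable_fun setT (fun x => ell (hist (t x))).
  exact: (measurableT_comp (measurable_next_loss mh) mt).
pose e z x := estimate eps z (tnth (ell (hist (t x))) (odflt ord0 z)).
rewrite (_ : (fun=> _) = fun x =>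
  (tnth (e (thead x).2 x) (a x) - tnth (e (thead x).2 x) (chi (a x))) +
  simulated_gain chi (t x)); last first.
  apply/funext => x; case/tupleP: x => w x.
  have tx : t [tuple of w :: x] = x by apply: val_inj.
  by rewrite simulated_gain_cons estE /e /a tx theadE.
apply: measurable_funD; last exact: (measurableT_comp IH mt).
have mz j : measurable_fun setT (fun x : n.+1.-tuple S => (thead x).2 == j).
  apply: (measurableT_comp (f := fun z : option 'I_k.+1 => z == j)) => //.
  exact: (measurableT_comp measurable_snd mth).
apply: (measurable_fun_fin_case (g := fun z x => tnth (e z x) (a x) -
  tnth (e z x) (chi (a x))) mz) => z.
apply: (measurable_fun_action_case (g := fun b x => tnth (e z x) b -
  tnth (e z x) (chi b)) ma) => b.
have me i : measurable_fun setT (fun x => tnth (e z x) i).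
  apply: (measurableT_comp (measurable_tnth i)).
  apply: (measurableT_comp (measurable_estimate eps z)).
  exact: (measurableT_comp (measurable_tnth _) ml).
exact: (measurable_funB (me b) (me (chi b))).
Qed.

(* The seed of the current round is not available to the adversary, but it only
   matters when exploiting, and then [estimate] ignores the loss: hence the dummy
   action ord0. *)
Definition derandomized_loss (zeta : nat -> option 'I_k.+1)
    (h : seq (seed A * 'I_k.+1 * loss_vector R k)) : loss_vector R k :=
  estimate eps (zeta (size h))
    (tnth (ell (hist (with_coins zeta [seq r.1.1 | r <- h])))
       (odflt ord0 (zeta (size h)))).

Lemma measurable_derandomized_loss zeta t : measurable_fun setT
  (fun h : t.-tuple (seed A * 'I_k.+1 * loss_vector R k) =>
     derandomized_loss zeta h).
Proof.
pose H := (seed A * 'I_k.+1 * loss_vector R k)%type.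
pose s (h : t.-tuple H) : t.-tuple (seed A) := [tuple of [seq r.1.1 | r <- h]].
have ms : measurable_fun setT s.
  apply/measurable_fun_tnthP => i.
  rewrite (_ : _ \o _ = fun h => (tnth h i).1.1).
    exact: (measurableT_comp measurable_fst
      (measurableT_comp measurable_fst (measurable_tnth i))).
  by apply/funext => h; rewrite /= tnth_map.
rewrite (_ : (fun=> _) = fun h : t.-tuple H => estimate eps (zeta t)
  (tnth (ell (hist (with_coins zeta (s h)))) (odflt ord0 (zeta t)))); last first.
  by apply/funext => h; rewrite /derandomized_loss size_tuple.
apply: (measurableT_comp (measurable_estimate eps (zeta t))).
apply: (measurableT_comp (measurable_tnth _)).
have mh := @measurable_history _ _ _ _ _ _ ell (@measurable_bandit R k) t.
exact: (measurableT_comp (measurable_next_loss mh)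
  (measurableT_comp (@measurable_with_coins _ _ _ _ zeta t) ms)).
Qed.

Definition derandomized zeta : adversary A :=
  Adversary (measurable_derandomized_loss zeta).

Lemma derandomized_losses zeta :
  losses_in (derandomized zeta) 0 (0 + k.+1%:R / eps%:num).
Proof. by move=> h i; rewrite add0r; apply: estimate_bounds; exact: ell01. Qed.

(** With [zeta] fixed, the seeds in the history of [A] determine the whole bandit history, so by
    induction [A] meets exactly the estimates fed to the copy. *)
Lemma run_derandomized zeta ws :
  run (@full_information R k) (derandomized zeta) ws =
  simulated eps (hist (with_coins zeta ws)).
Proof.
have obs_id s : map (@observed R k _ _ (@full_information R k) A) s = s.
  by apply: map_id_in => -[].
elim: ws => //= w ws IH; rewrite !obs_id !IH.
have seeds : [seq r.1.1 | r <- simulated eps (hist (with_coins zeta ws))] = ws.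
  by rewrite -IH; elim: (ws) => //= v vs ->.
have sizeE : size (simulated eps (hist (with_coins zeta ws))) = size ws.
  by rewrite -[in RHS]seeds size_map.
rewrite /derandomized_loss seeds sizeE.
(* For [None] both estimates are zero; for [Some j] MonoBandit plays [j], the action used in
   [derandomized_loss]. *)
by case: (zeta (size ws)).
Qed.

Lemma swap_gain_derandomized zeta chi ws :
  swap_gain (@full_information R k) (derandomized zeta) chi ws =
  simulated_gain chi (with_coins zeta ws).
Proof. by rewrite /swap_gain run_derandomized. Qed.

Lemma norm_simulated_gain_cons chi wz x :
  `|simulated_gain chi (wz :: x) - simulated_gain chi x| <= k.+1%:R / eps%:num.
Proof. by rewrite simulated_gain_cons addrK; apply: norm_gain. Qed.

(** The bound for each coin sequence is averaged by [ge0_integral_iid_prod_le], after a shift to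
    nonnegative integrands. *)
Lemma expectation_simulated_gain_le chi n (b : R) :
  (forall zeta, 'E_(iid (law A) n)[fun ws =>
     swap_gain (@full_information R k) (derandomized zeta) chi ws] <= b%:E)%E ->
  ('E_(iid (law A \x exploration_law k eps)%E n)[fun x => simulated_gain chi x]
     <= b%:E)%E.
Proof.
move=> hb; set c := k.+1%:R / eps%:num.
have S0 : simulated_gain chi [::] = 0 by rewrite /simulated_gain big_nil.
have Sc (x : n.-tuple (seed A * option 'I_k.+1)) : `|simulated_gain chi x| <= n%:R * c.
  by have := norm_le_size x S0 (norm_simulated_gain_cons chi); rewrite size_tuple.
rewrite -(@leeD2rE _ (n%:R * c)%:E) //.
have mS := @measurable_simulated_gain chi n.
rewrite -(expectationD_cst _ _ mS Sc) unlock.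
apply: ge0_integral_iid_prod_le => [|x|zeta].
- by apply/measurable_EFinP; exact: measurable_funD.
- by rewrite lee_fin; have := Sc x; rewrite ler_norml; lra.
have mz := @measurable_with_coins _ (seed A) _ (option 'I_k.+1) zeta n.
have := expectationD_cst (iid (law A) n) (n%:R * c) (measurableT_comp mS mz)
  (fun ws => Sc [tuple of with_coins zeta ws]).
rewrite unlock => /= ->; apply: leeD2r.
have := hb zeta; rewrite unlock.
by under eq_integral do rewrite swap_gain_derandomized.
Qed.

(** The gain splits as [D + p * S], with [S] the simulated gain and [p] the probability of
    exploiting. The expectation of [S] is at most [b], and [D] drifts by at most [eps] per round. *)
Lemma expectation_mono_gain_le chi n (b : R) : 0 < eps%:num :> R ->
  (forall zeta, 'E_(iid (law A) n)[fun ws =>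
     swap_gain (@full_information R k) (derandomized zeta) chi ws] <= b%:E)%E ->
  ('E_(iid (law (MonoBandit eps A)) n)[fun x => swap_gain (@bandit R k) ell chi x]
     <= ((1 - eps%:num) * b + n%:R * eps%:num)%:E)%E.
Proof.
move=> eps0 hb; pose p : R := 1 - eps%:num.
have p01 : 0 <= p <= 1.
  by rewrite /p subr_ge0 lerBlDr lerDl (ltW eps0) andbT.
pose K : R := k.+1%:R; have K0 : K != 0 by rewrite pnatr_eq0.
(* Bounds one increment of [D]: 1 comes from the true losses, [K / eps] from the estimates. *)
pose c := 1 + K / eps%:num.
pose S (x : seq (seed A * option 'I_k.+1)) := simulated_gain chi x.
pose D (x : seq (seed A * option 'I_k.+1)) :=
  swap_gain (@bandit R k) ell chi x - S x * p.
have mM m := measurable_swap_gain ell (@measurable_bandit R k) chi (n := m).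
have mS m := @measurable_simulated_gain chi m.
have mD m : measurable_fun setT
    (fun x : m.-tuple (seed A * option 'I_k.+1) => D x).
  exact: (measurable_funB (mM m) (measurable_funM (mS m) (measurable_cst p))).
have S0 : S [::] = 0 by rewrite /S /simulated_gain big_nil.
have D0 : D [::] = 0 by rewrite /D S0 /swap_gain big_nil mul0r subr0.
have Dcons wz x : D (wz :: x) - D x =
  (tnth (ell (hist x)) (mono_act eps (hist x) wz) -
   tnth (ell (hist x)) (chi (mono_act eps (hist x) wz))) -
  (S (wz :: x) - S x) * p.
  by rewrite /D swap_gain_cons /=; ring.
have Dc wz x : `|D (wz :: x) - D x| <= c.
  rewrite Dcons; apply: (le_trans (ler_normB _ _)); apply: lerD.
    by apply: norm_gain; exact: ell01.
  rewrite normrM (ger0_norm (x := p)); last by case/andP: p01.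
  have := norm_simulated_gain_cons chi wz x; rewrite -/(S _) -/(S _) => Sc.
  by apply: le_trans Sc; rewrite ler_piMr //; case/andP: p01.
have Ddrift x : ('E_(law A \x exploration_law k eps)%E[fun wz =>
    (D (wz :: x) - D x)%R] <= (eps%:num)%:E)%E.
  (* Only the coin is averaged; the fixed seed [w] determines the copy's action [a]. *)
  apply: (@expectation_prod_le _ _ _ _ _ _ _ _ c) => [|wz|w].
  - apply: measurable_funB => //.
    have mx := mD (size x).+1.
    exact: (measurableT_comp mx (measurableT_comp
      (@measurable_cons_tuple _ _ _) (measurable_pair2 (in_tuple x)))).
  - exact: Dc.
  rewrite expectation_exploration lee_fin.
  set l := ell (hist x); set a := mono_act eps (hist x) (w, None).
  have -> : D ((w, None) :: x) - D x = tnth l a - tnth l (chi a).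
    rewrite Dcons /S simulated_gain_cons addrK estE !tnth_estimate /=.
    by rewrite subr0 mul0r subr0.
  (* By [sum_estimate], the simulated gains over all explorations add up to [K / eps] times the true
     gain of [a]. *)
  have -> : \sum_(j < k.+1) (D ((w, Some j) :: x) - D x) =
      \sum_(j < k.+1) (tnth l j - tnth l (chi j)) -
      K / eps%:num * (tnth l a - tnth l (chi a)) * p.
    under eq_bigr => j _.
      rewrite Dcons /S simulated_gain_cons addrK estE /= -/l -/a; over.
    by rewrite sumrB -mulr_suml !sumrB !sum_estimate -mulrBr.
  have : \sum_(j < k.+1) (tnth l j - tnth l (chi j)) <= K.
    rewrite /K -[X in X%:R]card_ord -sumr_const; apply: ler_sum => j _.
    by have := norm_gain j (chi j) (ell01 (hist x)); rewrite ler_norml => /andP[].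
  set s := \sum_(j < k.+1) _; set g := tnth l a - _ => sK.
  (* The exploitation term cancels against the simulated gain weighted by [p]; what remains is [eps]
     times the mean gain of a uniformly random action. *)
  have -> : (1 - eps%:num) * g + eps%:num / k.+1%:R * (s - K / eps%:num * g * p)
      = eps%:num * (s / K).
    by rewrite /p; field; rewrite nat1r K0 (gt_eqF eps0).
  apply: ler_piMr; first exact: ltW.
  by rewrite ler_pdivrMr ?mul1r // ltr0n.
have := expectation_iid_drift n mD D0 Dc Ddrift => ED.
have ES := expectation_simulated_gain_le hb.
pose X := (n.-tuple (seed A * option 'I_k.+1))%type.
have Db (x : X) : `|D x| <= n%:R * c.
  by have := norm_le_size x D0 Dc; rewrite size_tuple.
have Sb (x : X) : `|S x| <= n%:R * (K / eps%:num).
  by have := norm_le_size x S0 (norm_simulated_gain_cons chi); rewrite size_tuple.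
have SL := bounded_Lfun1 (iid (law A \x exploration_law k eps)%E n) (mS n) Sb.
have pSb (x : X) : `|S x * p| <= n%:R * (K / eps%:num) * p.
  rewrite normrM (ger0_norm (x := p)); last by case/andP: p01.
  by rewrite ler_wpM2r //; case/andP: p01.
have pSL := bounded_Lfun1 (iid (law A \x exploration_law k eps)%E n)
  (measurable_funM (mS n) (measurable_cst p)) pSb.
have DL := bounded_Lfun1 (iid (law A \x exploration_law k eps)%E n) (mD n) Db.
have -> : (fun x : X => swap_gain (@bandit R k) ell chi x) =
    (fun x : X => D x) \+ (p \o* (fun x : X => S x)).
  by apply/funext => x; rewrite /D /= subrK.
rewrite expectationD // expectationZl //.
rewrite [leRHS](_ : _ = (n%:R * eps%:num)%:E + p%:E * b%:E)%E; last first.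
  by rewrite -EFinM -EFinD addrC.
apply: leeD => //; apply: lee_wpmul2l => //.
by rewrite lee_fin; case/andP: p01.
Qed.

End reduction.

(** The maximum over [chi] stands outside the expectation, so each [chi] can be treated
    separately. *)
Lemma SReg_leP (R : realType) (k : nat) dO (O : measurableType dO)
    (feedback : loss_vector R k -> 'I_k.+1 -> O) (A : algorithm R k O)
    (ell : adversary A) (T : nat) (b : R) :
  (SReg feedback ell T <= b%:E)%E <->
  (forall chi, 'E_(iid (law A) T)[fun ws => swap_gain feedback ell chi ws]
     <= b%:E)%E.
Proof.
split=> [+ chi|gain_le]; last first.
  by apply: bigmax_le => [|chi _]; [exact: leNye|exact: gain_le].
have -> : chi = finfun chi :> (_ -> _) by apply/funext => i; rewrite ffunE.
by apply: le_trans; exact: (le_bigmax_cond _ (fun chi : {ffun 'I_k.+1 -> 'I_k.+1} =>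
  'E_(iid (law A) T)[fun ws => swap_gain feedback ell chi ws])%E).
Qed.

(** * Positivity of the regret bound for at least two actions *)

Section spike.
Context (R : realType) (k n : nat) (A : algorithm R k (loss_vector R k)).

(** A history of size [n] marks the last of [n.+1] rounds, so [A] cannot react to [a]. *)
Definition spike_loss (a : 'I_k.+1)
    (h : seq (seed A * 'I_k.+1 * loss_vector R k)) : loss_vector R k :=
  [tuple if (size h == n) && (i == a) then 1 else 0 | i < k.+1].

Lemma measurable_spike_loss a t : measurable_fun setT
  (fun h : t.-tuple (seed A * 'I_k.+1 * loss_vector R k) => spike_loss a h).
Proof.
rewrite (_ : (fun=> _) =
    cst [tuple if (t == n) && (i == a) then 1 else 0 | i < k.+1]) //.
by apply/funext => h; rewrite /spike_loss size_tuple.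
Qed.

Definition spike a : adversary A := Adversary (measurable_spike_loss a).

Lemma spike_losses a : losses_in (spike a) 0 (0 + 1).
Proof. by move=> h i; rewrite /= tnth_mktuple; case: ifP; lra. Qed.

Let full := @full_information R k.

Lemma eq_run_spike a a' ws : (size ws <= n)%N ->
  run full (spike a) ws = run full (spike a') ws.
Proof.
elim: ws => //= w ws IH lt_ws_n; rewrite IH 1?ltnW //; congr ((_, _) :: _).
apply: eq_from_tnth => i; rewrite !tnth_mktuple.
by rewrite -/(history _ _ _) size_history (ltn_eqF lt_ws_n).
Qed.

Lemma swap_gain_spike0 chi a ws : (size ws <= n)%N ->
  swap_gain full (spike a) chi ws = 0.
Proof.
elim: ws => [|w ws IH] lt_ws_n; first by rewrite /swap_gain big_nil.
rewrite swap_gain_cons IH 1?ltnW // !tnth_mktuple.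
by rewrite size_history (ltn_eqF lt_ws_n) subr0 addr0.
Qed.

(** The reference index [a0] makes the last action on the right independent of [a], so that the
    gains can be summed over [a]. *)
Lemma swap_gain_spike a a' a0 w ws : a' != a -> size ws = n ->
  swap_gain full (spike a) (fun=> a') (w :: ws) =
  (act (history full (spike a0) ws) w == a)%:R.
Proof.
move=> a'a size_ws; rewrite swap_gain_cons swap_gain_spike0 ?size_ws //.
rewrite !tnth_mktuple size_history size_ws eqxx (negPf a'a) subr0 addr0 /=.
have -> : history full (spike a) ws = history full (spike a0) ws.
  by rewrite /history (@eq_run_spike a a0) ?size_ws.
by case: eqP.
Qed.

(** Each [a] is played last with probability at most [b]; summing over [a] gives [1 <= k.+1 * b]. *)
Lemma regret_bound_gt0 (b : R) : (0 < k)%N ->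
  (forall (a c : R) (ell : adversary A), 0 < c -> losses_in ell a (a + c) ->
     (SReg full ell n.+1 <= (c * b)%:E)%E) -> 0 < b.
Proof.
move=> k0 hA; pose other (a : 'I_k.+1) : 'I_k.+1 := if a == ord0 then ord_max else ord0.
have otherP a : other a != a.
  rewrite /other; case: (eqVneq a ord0) => [->|]; last by rewrite eq_sym.
  by rewrite -val_eqE /= -lt0n.
pose g a (ws : n.+1.-tuple (seed A)) := swap_gain full (spike a) (fun=> other a) ws.
have gE a (ws : n.+1.-tuple (seed A)) : g a ws =
    (act (history full (spike ord0) (behead ws)) (thead ws) == a)%:R.
  case/tupleP: ws => w ws; rewrite theadE.
  by rewrite /g (@swap_gain_spike a (other a) ord0) ?otherP ?size_tuple.
have g0 a ws : 0 <= g a ws by rewrite gE.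
have mg a : measurable_fun setT (g a).
  exact: (measurable_swap_gain _ (@measurable_full_information R k)).
have gb a : ('E_(iid (law A) n.+1)[g a] <= b%:E)%E.
  have /SReg_leP := hA 0 1 (spike a) ltr01 (@spike_losses a).
  by rewrite mul1r; exact.
have : (\sum_(a < k.+1) 'E_(iid (law A) n.+1)[g a] <= \sum_(a < k.+1) b%:E)%E.
  by apply: lee_sum => a _.
(* Pointwise exactly one of these indicators, that of the action played last, equals 1. *)
have -> : (\sum_(a < k.+1) 'E_(iid (law A) n.+1)[g a] = 1%:E)%E.
  rewrite -(expectation_cst (iid (law A) n.+1) 1).
  rewrite expectation.unlock /=.
  rewrite -ge0_integral_sum //.
  - apply: eq_integral => ws _; rewrite sumEFin; congr _%:E.
    under eq_bigr do rewrite gE.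
    set s := act _ _; rewrite (bigD1 s) //= eqxx big1 ?addr0 // => a.
    by rewrite eq_sym => /negPf ->.
  - by move=> a; apply/measurable_EFinP.
  - by move=> a ws _; rewrite lee_fin.
rewrite sumEFin sumr_const card_ord lee_fin -mulr_natl => b1.
by rewrite -(pmulr_rgt0 _ (ltr0Sn R k)) (lt_le_trans _ b1).
Qed.

End spike.

(** * The choice of [eps] and the final bound *)

Lemma swap_gain_id (R : realType) (k : nat) dO (O : measurableType dO)
    (feedback : loss_vector R k -> 'I_k.+1 -> O) (A : algorithm R k O)
    (ell : adversary A) chi ws :
  (forall i, chi i = i) -> swap_gain feedback ell chi ws = 0.
Proof. by move=> chi_id; rewrite /swap_gain big1 // => r _; rewrite chi_id subrr. Qed.

(* The choice of [eps] balances [K / eps * r] against [T * eps]. *)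
Lemma mono_eps_regret (R : realType) (k T : nat) (r : R) :
  (0 < T)%N -> 0 < r -> 0 < (mono_eps k T r)%:num /\
  (1 - (mono_eps k T r)%:num) * (k.+1%:R / (mono_eps k T r)%:num * r) +
    T%:R * (mono_eps k T r)%:num <= 2 * Num.sqrt (k.+1%:R * T%:R * r).
Proof.
move=> T0 r0; set e : R := (mono_eps k T r)%:num.
pose K : R := k.+1%:R; pose t : R := T%:R.
have K0 : 0 < K by rewrite ltr0n.
have t0 : 0 < t by rewrite ltr0n.
set s := Num.sqrt _.
have s2 : s ^+ 2 = K * t * r by rewrite sqr_sqrtr // !mulr_ge0 // ltW.
have s0 : 0 < s by rewrite sqrtr_gt0 !mulr_gt0.
(* [K * r / t] is the square of [s / t]. *)
have eE : e = Num.min 1 (s / t).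
  rewrite /e /= -/K -/t; congr (Num.min _ _).
  rewrite -[RHS]ger0_norm ?divr_ge0 ?ltW // -sqrtr_sqr; congr Num.sqrt.
  by rewrite expr_div_n s2; field; rewrite gt_eqF.
have e0 : 0 < e by rewrite eE lt_min ltr01 divr_gt0.
split => //; rewrite -/K -/t.
have s2e : s ^+ 2 / s = s by rewrite expr2 mulfK // gt_eqF.
(* If [e] is capped at 1, the first term vanishes and the second is [t < s]. *)
move: eE; rewrite minElt; case: ifP => [lt1st e1|/negbT].
  have : t < s by move: lt1st; rewrite ltr_pdivlMr ?mul1r.
  by rewrite e1; lra.
rewrite -leNgt => le_st e_st.
(* Otherwise [e = s / t], and the total is [(1 - e) * s + s]. *)
have -> : K / e * r = s.
  rewrite -s2e s2 e_st; field; rewrite !gt_eqF //.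
have -> : t * e = s by rewrite e_st; field; rewrite gt_eqF.
by have := mulr_gt0 e0 s0; lra.
Qed.

Theorem lemma16 (R : realType) (k : nat) (bound : nat -> R) (T : nat)
    (A : algorithm R k (loss_vector R k)) :
  (forall (a c : R) (ell : adversary A),
     0 < c -> losses_in ell a (a + c) ->
     (SReg (@full_information R k) ell T <= (c * bound T)%:E)%E) ->
  forall ell : adversary (MonoBandit (mono_eps k T (bound T)) A),
    losses_in ell 0 1 ->
    (SReg (@bandit R k) ell T
       <= (2 * Num.sqrt (k.+1%:R * T%:R * bound T))%:E)%E.
Proof.
move=> hA ell ell01; apply/SReg_leP => chi.
(* [Num.sqrt] is 0 on negative arguments, so the right side is nonnegative whatever the sign of
   [bound T]. *)
have zero_case : (forall ws : T.-tuple _, swap_gain (@bandit R k) ell chi ws = 0) ->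
    ('E_(iid (law (MonoBandit (mono_eps k T (bound T)) A)) T)[fun ws =>
       swap_gain (@bandit R k) ell chi ws]
     <= (2 * Num.sqrt (k.+1%:R * T%:R * bound T))%:E)%E.
  move=> gain0; rewrite (_ : (fun=> _) = cst 0); last exact/funext.
  by rewrite expectation_cst lee_fin mulr_ge0.
(* [k = 0] means a single action, for which every [chi] is the identity. *)
have [k0|k_gt0] := posnP k.
  have ord_eq0 (i : 'I_k.+1) : i = 0%N :> nat.
    by move: (nat_of_ord i) (ltn_ord i) => m; rewrite k0 ltnS leqn0 => /eqP.
  apply: zero_case => ws; apply: swap_gain_id => i; apply: val_inj.
  by rewrite /= !ord_eq0.
have [T0|T_gt0] := posnP T.
  by apply: zero_case => ws; rewrite (size0nil (etrans (size_tuple ws) T0)) /swap_gain big_nil.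
have b0 : 0 < bound T.
  by apply: (@regret_bound_gt0 R k T.-1 A) => //; rewrite prednK.
have [eps0 regret_le] := mono_eps_regret k T_gt0 b0.
apply: (le_trans _ (_ : (_%:E <= _)%E)); last by rewrite lee_fin; exact: regret_le.
apply: expectation_mono_gain_le => // zeta.
(* The losses lie in an interval of length [k.+1 / eps], which is positive because [eps] is, so [hA]
   bounds the regret by that length times [bound T]. *)
have /SReg_leP := hA 0 _ _ (divr_gt0 (ltr0Sn R k) eps0) (derandomized_losses ell01 zeta).
exact.
Qed.
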